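(* Let $L_1(x)=P_0+P_1 x\in \mathbb{S}\mathbb{R}^{d\times d}[x]$ be a linear polynomial in one variable $x$ such that the set $D_{L_1}(1)=\{x\in\mathbb{R}\mid L_1(x)\succeq 0\}$ has an interior point (in $\mathbb{R}$). Then for every linear polynomial $L_2(x)=R_0+R_1 x\in \mathbb{S}\mathbb{R}^{\ell\times \ell}[x]$ with $L_2|_{D_{L_1}(1)} \succeq 0$ (that is, $L_2(x)$ is positive semidefinite for every $x\in D_{L_1}(1)$), there are finitely many matrix polynomials $A_j\in \mathbb{R}^{\ell\times \ell}[x]$ and $B_k\in \mathbb{R}^{d\times \ell}[x]$ satisfying $$L_2=\sum_j A_j^{\ast}A_j+\sum_k B_k^{\ast}L_1 B_k.$$
   Context: Here $x$ is a single real variable. $\mathbb{R}^{p\times q}[x]$ denotes the set of all polynomials in $x$ whose coefficients are real $p\times q$ matrices, and $\mathbb{S}\mathbb{R}^{d\times d}[x]$ denotes the set of those whose coefficients are symmetric real $d\times d$ matrices. Thus $P_0,P_1$ are real symmetric $d\times d$ matrices and $R_0,R_1$ are real symmetric $\ell\times\ell$ matrices. $M^\ast$ is the transpose of a matrix polynomial $M$. $\succeq 0$ means positive semidefinite. *)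

(* Defs.v *)
From HB Require Import structures.
From mathcomp Require Import all_boot all_order all_algebra.
From mathcomp Require Import classical_sets reals topology normedtype.

Set Implicit Arguments.
Unset Strict Implicit.
Unset Printing Implicit Defensive.

Import Order.TTheory GRing.Theory Num.Theory.
Import numFieldNormedType.Exports.

Local Open Scope ring_scope.
Local Open Scope classical_set_scope.

(* A polynomial with p x q matrix coefficients is represented as a p x q matrix
   with polynomial entries, since 'M[R]_(p, q) is not a ring when p != q. *)

Definition linpoly (R : realType) (n : nat) (M0 M1 : 'M[R]_n) :
    'M[{poly R}]_n :=
  map_mx polyC M0 + 'X *: map_mx polyC M1.

Definition mxeval (R : realType) (p q : nat) (M : 'M[{poly R}]_(p, q)) (x : R) :
    'M[R]_(p, q) :=
  map_mx (horner_eval x) M.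

Definition psdmx (R : realType) (n : nat) (M : 'M[R]_n) : Prop :=
  M \is symmetricmx /\ forall v : 'cV[R]_n, 0 <= (v^T *m M *m v) 0 0.

Definition posset (R : realType) (n : nat) (L : 'M[{poly R}]_n) : set R :=
  [set x : R | psdmx (mxeval L x)].

Lemma mxeval_linpoly (R : realType) (n : nat) (M0 M1 : 'M[R]_n) (x : R) :
  mxeval (linpoly M0 M1) x = M0 + x *: M1.
Proof. by apply/matrixP => i j; rewrite !mxE /horner_eval !hornerE. Qed.

Lemma symmetricmxE (R : realType) (n : nat) (M : 'M[R]_n) :
  (M \is symmetricmx) = (M == M^T).
Proof. by rewrite qualifE /= expr0 scale1r map_mx_id. Qed.

(* Main.v *)
Require Import Defs.
From HB Require Import structures.
From mathcomp Require Import all_boot all_order all_algebra.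
From mathcomp Require Import classical_sets reals topology normedtype.
From mathcomp Require Import boolp ring lra.

Set Implicit Arguments.
Unset Strict Implicit.
Unset Printing Implicit Defensive.

Import Order.TTheory GRing.Theory Num.Theory.
Import numFieldNormedType.Exports.

Local Open Scope ring_scope.
Local Open Scope classical_set_scope.

(** Write L1 = P0 + P1 x, L2 = R0 + R1 x and D = { x | L1(x) is PSD }.  D is a
    closed interval with more than one point, and the certificate reflects its
    shape.

    The heart of the matter is that a finite endpoint a of D is detected by a
    single vector: there is v such that the scalar polynomial v^T L1 v is
    exactly x - a for a left endpoint, a - x for a right one ([pencil_edge]).
    To find v for a = inf D, factor L1(a) = C^T C.  If ker C were contained in
    ker P1, then P1 = C^T N C for some N, and
    L1(a - t) = C^T (I - t N) C would still be PSD for small t > 0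
    ([psdmx_perturb]), contradicting the choice of a.  So some v in ker C has
    P1 v <> 0; the form of L1 vanishes on v at a, and its slope v^T P1 v is
    nonnegative, as D lies to the right of a.  The slope is not 0,
    since otherwise v would also be isotropic, hence in the kernel, for
    L1 at another point of D, which forces P1 v = 0.  Rescale v.

    Multiplying v by the rows of a factor of a constant PSD matrix S,
    (v^T L1 v) S has the required shape ([in_module_qform]).  It remains to
    write L2 with such terms:
    - if D = [a, b], then
      L2 = ((x - a) L2(b) + (b - x) L2(a)) / (b - a);
    - if D is unbounded above, R1 is PSD, because L2 stays PSD arbitrarily far
      to the right; if moreover D has a left endpoint a, then
      L2 = L2(a) + (x - a) R1; the case unbounded below is symmetric;
    - if D is unbounded on both sides, R1 = 0 and L2 is a constant PSD matrix. *)

(** * Quadratic forms *)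

Definition qform (R : comPzRingType) (n : nat) (M : 'M[R]_n) (v : 'cV[R]_n) : R :=
  (v^T *m M *m v) 0 0.

Lemma qformD (R : comPzRingType) (n : nat) (M N : 'M[R]_n) (v : 'cV[R]_n) :
  qform (M + N) v = qform M v + qform N v.
Proof. by rewrite /qform mulmxDr mulmxDl [LHS]mxE. Qed.

Lemma qformZ (R : comPzRingType) (n : nat) (k : R) (M : 'M[R]_n) (v : 'cV[R]_n) :
  qform (k *: M) v = k * qform M v.
Proof. by rewrite /qform -scalemxAr -scalemxAl [LHS]mxE. Qed.

Lemma qformZv (R : comPzRingType) (n : nat) (k : R) (M : 'M[R]_n) (v : 'cV[R]_n) :
  qform M (k *: v) = k ^+ 2 * qform M v.
Proof.
by rewrite /qform -scalemxAr [(_ *: _)^T]linearZ /= -!scalemxAl scalerA mxE expr2.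
Qed.

Lemma qform_congr (R : comPzRingType) (n m : nat) (N : 'M[R]_m)
    (C : 'M[R]_(m, n)) (v : 'cV[R]_n) :
  qform (C^T *m N *m C) v = qform N (C *m v).
Proof. by rewrite /qform trmx_mul !mulmxA. Qed.

Lemma qform1 (R : comPzRingType) (n : nat) (v : 'cV[R]_n) :
  qform 1%:M v = \sum_i v i 0 ^+ 2.
Proof.
rewrite /qform mulmx1 mxE; apply: eq_bigr => i _.
by rewrite mxE expr2.
Qed.

Lemma qform_gram (R : comPzRingType) (m n : nat) (C : 'M[R]_(m, n)) v :
  qform (C^T *m C) v = \sum_i (C *m v) i 0 ^+ 2.
Proof. by rewrite -[X in _ *m X]mul1mx mulmxA qform_congr qform1. Qed.

(** * Positive semidefinite matrices *)

Lemma psdmxP (R : realType) (n : nat) (M : 'M[R]_n) :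
  psdmx M <-> M^T = M /\ forall v, 0 <= qform M v.
Proof.
rewrite /psdmx symmetricmxE.
by split=> -[/[dup] s + p]; [move/eqP=> <- | move=> ->].
Qed.

Lemma qform_block (R : comPzRingType) (n : nat) (a : R) (w : 'rV[R]_n)
    (M : 'M[R]_n) (t : R) (u : 'cV[R]_n) :
  qform (block_mx a%:M w w^T M) (col_mx t%:M u)
    = a * t ^+ 2 + 2 * t * (w *m u) 0 0 + qform M u.
Proof.
have E : (u^T *m w^T) 0 0 = (w *m u) 0 0 by rewrite -trmx_mul mxE.
rewrite /qform tr_col_mx mul_row_block mul_row_col !mulmxDl tr_scalar_mx.
rewrite -!scalar_mxM !mul_mx_scalar !mul_scalar_mx -!scalemxAl.
rewrite !mxE in E *. rewrite E eqxx mulr1n. ring.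
Qed.

(** Cholesky factorization, by Schur complements.  With corner entry a, the
    first row of the factor is (sqrt a, w / sqrt a).  The same formula covers
    a = 0, thanks to 0^-1 = 0: positivity then forces w = 0. *)
Lemma psdmx_gram (R : realType) (n : nat) (M : 'M[R]_n) :
  psdmx M -> exists C : 'M[R]_n, M = C^T *m C.
Proof.
elim: n M => [|n IHn] M; first by exists 0; apply/matrixP => -[].
rewrite -(@submxK _ 1 n 1 n M) [@ulsubmx _ 1 n 1 n M]mx11_scalar.
set a := _ 0 0; set w := ursubmx _; set w' := dlsubmx _; set N := drsubmx _.
move/psdmxP.
rewrite (@tr_block_mx _ 1 n 1 n) => -[/(@eq_block_mx _ 1 n 1 n)[_ _ wE NE] M_ge0].
have {}M_ge0 t u : 0 <= a * t ^+ 2 + 2 * t * (w *m u) 0 0 + qform N u.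
  by rewrite -qform_block wE; apply: M_ge0.
rewrite -wE.
have a_ge0 : 0 <= a.
  by have := M_ge0 1 0; rewrite /qform !mulmx0 !mxE; lra.
have w0 : a = 0 -> w = 0.
  move=> a0; apply/matrixP => i j; rewrite (ord1 i) [RHS]mxE.
  pose u : 'cV[R]_n := delta_mx j 0.
  have wu : (w *m u) 0 0 = w 0 j by rewrite -colE mxE.
  (* The form is affine in t, with slope 2 w_j; this t makes it equal -1. *)
  have := M_ge0 (- (qform N u + 1) / (2 * w 0 j)) u; rewrite wu a0 mul0r add0r.
  case: (eqVneq (w 0 j) 0) => // wj.
  rewrite (_ : 2 * _ * _ = - (qform N u + 1)); first lra.
  by field.
pose s := Num.sqrt a.
have sa : s ^+ 2 = a by rewrite sqr_sqrtr.
have sw : s *: (s^-1 *: w) = w.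
  case: (eqVneq s 0) => [s0|s0]; last by rewrite scalerA divff ?scale1r.
  by rewrite w0 ?scaler0 // -sa s0 expr0n.
have /IHn[C CE] : psdmx (N - (s^-1 *: w)^T *m (s^-1 *: w)).
  apply/psdmxP; split; first by rewrite linearB /= trmx_mul trmxK NE.
  move=> u; rewrite -scaleN1r qformD qformZ qform_gram big_ord1.
  rewrite -scalemxAl [X in X ^+ 2]mxE.
  (* The first coordinate - w u / a minimizes the form for a given u. *)
  have := M_ge0 (- ((w *m u) 0 0) * s^-1 ^+ 2) u.
  set p := (w *m u) 0 0; move=> H.
  suff -> : -1 * (s^-1 * p) ^+ 2
     = a * (- p * s^-1 ^+ 2) ^+ 2 + 2 * (- p * s^-1 ^+ 2) * p.
    by rewrite addrC.
  rewrite -sa; case: (eqVneq s 0) => [->|s0]; last by field.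
  by rewrite invr0; ring.
exists (block_mx s%:M (s^-1 *: w) 0 C).
rewrite (@tr_block_mx _ 1 n 1 n) (@mulmx_block _ 1 n 1 n 1 n).
rewrite !trmx0 !mul0mx !mulmx0 !addr0 -CE tr_scalar_mx -scalar_mxM -expr2 sa.
rewrite mul_scalar_mx mul_mx_scalar sw -[in RHS]linearZ sw /=.
by rewrite addrC subrK.
Qed.

Lemma psdmxZ (R : realType) (n : nat) (k : R) (M : 'M[R]_n) :
  0 <= k -> psdmx M -> psdmx (k *: M).
Proof.
move=> k0 /psdmxP[Ms Mp]; apply/psdmxP; split; first by rewrite linearZ /= Ms.
by move=> v; rewrite qformZ mulr_ge0.
Qed.

(** Isotropic vectors of a PSD matrix C^T C are in its kernel, because the
    form is the sum of squares of the entries of C v. *)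
Lemma psdmx_qform0 (R : realType) (n : nat) (M : 'M[R]_n) (v : 'cV[R]_n) :
  psdmx M -> qform M v = 0 -> M *m v = 0.
Proof.
move=> /psdmx_gram[C ->]; rewrite qform_gram => /eqP.
rewrite psumr_eq0 => [/allP Cv0|i _]; last exact: sqr_ge0.
rewrite -mulmxA (_ : C *m v = 0) ?mulmx0 //; apply/matrixP => i j.
by have := Cv0 i (mem_index_enum _); rewrite sqrf_eq0 (ord1 j) [RHS]mxE => /eqP.
Qed.

Lemma qform_bound (R : realType) (n : nat) (N : 'M[R]_n) :
  exists2 K : R, 0 < K & forall v, qform N v <= K * \sum_i v i 0 ^+ 2.
Proof.
exists (1 + \sum_j \sum_i `|N i j|) => [|v].
  rewrite ltr_pwDl //; apply: sumr_ge0 => i _; exact: sumr_ge0.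
set S := \sum_i v i 0 ^+ 2.
have S0 : 0 <= S by apply: sumr_ge0 => i _; apply: sqr_ge0.
have vS i : v i 0 ^+ 2 <= S.
  by rewrite /S (bigD1 i) //= lerDl sumr_ge0 // => j _; apply: sqr_ge0.
rewrite mulrDl mul1r; apply: ler_wpDl => //.
rewrite /qform mxE mulr_suml; apply: ler_sum => j _.
rewrite mxE !mulr_suml; apply: ler_sum => i _; rewrite mxE.
apply: (le_trans (ler_norm _)); rewrite !normrM mulrAC mulrC.
apply: ler_wpM2l => //; rewrite -normrM.
have := vS i; have := vS j; rewrite ler_norml; nra.
Qed.

(** The condition (N <= C)%MS on row spaces says that ker C is contained in
    ker N.  Since N is symmetric, it factors on both sides through C, as
    N = C^T G C, so that C^T C - t N = C^T (I - t G) C, and I - t G has a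
    nonnegative form for small t. *)
Lemma psdmx_perturb (R : realType) (m n : nat) (C : 'M[R]_(m, n))
    (N : 'M[R]_n) :
  N^T = N -> (N <= C)%MS ->
  exists2 t : R, 0 < t & psdmx (C^T *m C - t *: N).
Proof.
move=> Ns NC; have [Y YE] := submxP NC.
have NE : N = C^T *m (Y^T *m pinvmx C) *m C.
  by rewrite -[LHS](mulmxKpV NC) -{1}Ns {1}YE trmx_mul !mulmxA.
have [K K0 KP] := qform_bound (Y^T *m pinvmx C).
exists K^-1; rewrite ?invr_gt0 //; apply/psdmxP; split=> [|v].
  by rewrite linearB linearZ /= trmx_mul trmxK Ns.
rewrite -scaleNr qformD qformZ NE qform_congr.
by rewrite qform_gram mulNr subr_ge0 mulrC ler_pdivrMr // mulrC; apply: KP.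
Qed.

(** * Endpoints of the positivity set of a linear pencil *)

Lemma qform_pencil (R : comPzRingType) (n : nat) (M0 M1 : 'M[R]_n) (y : R)
    (v : 'cV[R]_n) :
  qform (M0 + y *: M1) v = qform M0 v + y * qform M1 v.
Proof. by rewrite qformD qformZ. Qed.

(** The positivity set is closed: for each v, an affine function that is
    negative at the infimum is also negative at points of the set close to it. *)
Lemma psdmx_pencil_inf (R : realType) (d : nat) (P0 P1 : 'M[R]_d)
    (D := [set y | psdmx (P0 + y *: P1)]) :
  P0^T = P0 -> P1^T = P1 -> has_inf D -> D (inf D).
Proof.
move=> P0s P1s Dinf; set a := inf D.
have aD y : D y -> a <= y by move=> Dy; apply: ge_inf => //; case: Dinf.
apply/psdmxP; split=> [|v]; first by rewrite linearD /= linearZ /= P0s P1s.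
rewrite qform_pencil leNgt; apply/negP => q0.
have [p0|p0] := leP (qform P1 v) 0.
  have [[y Dy] _] := Dinf.
  have /psdmxP[_ /(_ v)] := Dy; rewrite qform_pencil.
  have := aD _ Dy; nra.
(* The affine function v^T (P0 + y P1) v vanishes at y = a + e. *)
pose e := - (qform P0 v + a * qform P1 v) / qform P1 v.
have e0 : 0 < e by rewrite divr_gt0 ?oppr_gt0.
have [y Dy] := inf_adherent e0 Dinf.
rewrite -/a -ltrBlDl ltr_pdivlMr // => ya.
have /psdmxP[_ /(_ v)] := Dy; rewrite qform_pencil; lra.
Qed.

(** The second point c2 of the positivity set is what excludes a pencil that
    is PSD at a single point.  For the pencil with rows (1, x) and (x, 0) the
    form v0^2 + 2 x v0 v1 never equals x. *)
Lemma pencil_edge (R : realType) (d : nat) (P0 P1 : 'M[R]_d) (c1 c2 z : R) :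
  P0^T = P0 -> P1^T = P1 ->
  c1 < c2 -> psdmx (P0 + c1 *: P1) -> psdmx (P0 + c2 *: P1) ->
  (forall y, psdmx (P0 + y *: P1) -> z <= y) ->
  exists a (v : 'cV[R]_d),
    [/\ psdmx (P0 + a *: P1), a <= c1, qform P0 v = - a & qform P1 v = 1].
Proof.
move=> P0s P1s c12 Dc1 Dc2 zD.
pose D := [set y | psdmx (P0 + y *: P1)].
have Dlb : has_lbound D by exists z => y; apply: zD.
have Dinf : has_inf D by split; first by exists c1.
pose a := inf D.
have aD y : D y -> a <= y by move=> Dy; apply: ge_inf.
have Da : D a by apply: psdmx_pencil_inf.
have [C CE] := psdmx_gram Da.
have PC : ~~ (P1 <= C)%MS.
  apply/negP => /(psdmx_perturb P1s)[t t0].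
  rewrite -CE -addrA -scalerBl => /aD.
  by rewrite lerBrDl gerDr leNgt t0.
(* The columns of the cokernel of C span the column vectors killed by C. *)
have [j vj] : exists j, P1 *m col j (cokermx C) != 0.
  apply/existsP; rewrite -negb_forall; apply: contra PC => /forallP P0j.
  rewrite submxE; apply/eqP/matrixP => i j.
  by have /eqP/matrixP/(_ i 0) := P0j j; rewrite colE mulmxA -colE !mxE.
pose v := col j (cokermx C).
have av0 : (P0 + a *: P1) *m v = 0.
  by rewrite CE /v colE mulmxA -(mulmxA C^T) mulmx_coker mulmx0 mul0mx.
have qa : qform P0 v + a * qform P1 v = 0.
  by rewrite -qform_pencil /qform -mulmxA av0 mulmx0 mxE.
have ac2 : 0 < c2 - a by rewrite subr_gt0 (le_lt_trans (aD _ Dc1)).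
have qc : qform (P0 + c2 *: P1) v = (c2 - a) * qform P1 v.
  by rewrite qform_pencil; move: qa; lra.
have k0 : 0 < qform P1 v.
  rewrite lt_neqAle; apply/andP; split; last first.
    by have /psdmxP[_ /(_ v)] := Dc2; rewrite qc pmulr_rge0.
  apply: contra vj => /eqP k0.
  have /(psdmx_qform0 Dc2) : qform (P0 + c2 *: P1) v = 0.
    by rewrite qc -k0 mulr0.
  rewrite -[LHS]subr0 -{1}av0 -mulmxBl opprD addrACA subrr add0r -scalerBl.
  by rewrite -scalemxAl => /eqP; rewrite scaler_eq0 gt_eqF.
pose s := (Num.sqrt (qform P1 v))^-1.
have sE2 : s ^+ 2 * qform P1 v = 1.
  by rewrite exprVn sqr_sqrtr ?ltW // mulVf // gt_eqF.
exists a, (s *: v); split=> //; first exact: aD.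
  rewrite qformZv (_ : qform P0 v = - a * qform P1 v); last by move: qa; lra.
  by rewrite mulrCA sE2 mulr1.
by rewrite qformZv.
Qed.

(** * Sums of hermitian squares weighted by a pencil *)

(** Membership in the quadratic module generated by L in l x l matrices. *)
Definition in_module (R : realType) (d l : nat) (L : 'M[{poly R}]_d)
    (M : 'M[{poly R}]_l) : Prop :=
  exists (A : seq 'M[{poly R}]_(l, l)) (B : seq 'M[{poly R}]_(d, l)),
    M = \sum_(Aj <- A) Aj^T *m Aj + \sum_(Bk <- B) Bk^T *m L *m Bk.

Lemma in_moduleD (R : realType) (d l : nat) (L : 'M[{poly R}]_d)
    (M N : 'M[{poly R}]_l) :
  in_module L M -> in_module L N -> in_module L (M + N).
Proof.
move=> [A [B ->]] [A' [B' ->]]; exists (A ++ A'), (B ++ B').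
by rewrite !big_cat addrACA.
Qed.

Lemma in_module_const (R : realType) (d l : nat) (L : 'M[{poly R}]_d)
    (M : 'M[R]_l) :
  psdmx M -> in_module L (map_mx polyC M).
Proof.
move=> /psdmx_gram[C ->]; exists [:: map_mx polyC C], [::].
by rewrite big_seq1 big_nil addr0 map_mxM -map_trmx.
Qed.

(** With M = C^T C, take the rank one matrices v *m row i C as multipliers:
    their contributions (v^T L v) (row i C)^T (row i C) add up. *)
Lemma in_module_qform (R : realType) (d l : nat) (L : 'M[{poly R}]_d)
    (v : 'cV[{poly R}]_d) (M : 'M[R]_l) :
  psdmx M -> in_module L (qform L v *: map_mx polyC M).
Proof.
move=> /psdmx_gram[C ->].
exists [::], [seq v *m row i (map_mx polyC C) | i <- enum 'I_l].
rewrite big_nil add0r big_map big_enum /= map_mxM -map_trmx.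
apply/matrixP => i j; rewrite mxE [in LHS]mxE mulr_sumr summxE.
apply: eq_bigr => k _.
rewrite trmx_mul -!mulmxA (mulmxA L) (mulmxA v^T) (mulmxA v^T).
rewrite [v^T *m L *m v]mx11_scalar mul_scalar_mx -scalemxAr [RHS]mxE.
by congr (_ * _); rewrite [RHS]mxE big_ord1 !mxE.
Qed.

Lemma qform_linpoly (R : realType) (d : nat) (P0 P1 : 'M[R]_d) (v : 'cV[R]_d) :
  qform (linpoly P0 P1) (map_mx polyC v)
    = (qform P0 v)%:P + 'X * (qform P1 v)%:P.
Proof.
rewrite /linpoly qformD qformZ /qform !map_trmx -!map_mxM.
by rewrite !mxE.
Qed.

Lemma affine_slope_ge0 (R : realType) (p q : R) :
  (forall z, exists2 y, z <= y & 0 <= p + y * q) -> 0 <= q.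
Proof.
move=> H; rewrite leNgt; apply/negP => q0.
have [y] := H ((1 + p) / - q); rewrite ler_pdivrMr ?oppr_gt0 //; lra.
Qed.

Theorem theorem4 (R : realType) (d : nat) (P0 P1 : 'M[R]_d)
    (P0_sym : P0 \is symmetricmx) (P1_sym : P1 \is symmetricmx)
    (int_D : interior (posset (linpoly P0 P1)) !=set0) :
  forall (l : nat) (R0 R1 : 'M[R]_l),
    R0 \is symmetricmx -> R1 \is symmetricmx ->
    (forall x : R, posset (linpoly P0 P1) x ->
       psdmx (mxeval (linpoly R0 R1) x)) ->
  exists (A : seq 'M[{poly R}]_(l, l)) (B : seq 'M[{poly R}]_(d, l)),
    linpoly R0 R1 =
      \sum_(Aj <- A) Aj^T *m Aj
      + \sum_(Bk <- B) Bk^T *m linpoly P0 P1 *m Bk.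
Proof.
move=> l R0 R1 R0_sym R1_sym L2D.
have symE n (M : 'M[R]_n) : M \is symmetricmx -> M^T = M.
  by rewrite symmetricmxE => /eqP.
move: P0_sym P1_sym R0_sym R1_sym => /symE P0s /symE P1s /symE R0s /symE R1s.
pose D x := psdmx (P0 + x *: P1).
have {}L2D x : D x -> psdmx (R0 + x *: R1).
  by rewrite -mxeval_linpoly => Dx; apply: L2D; rewrite /posset /= mxeval_linpoly.
have [c1 [c2 [c12 Dc1 Dc2]]] : exists c1 c2, [/\ c1 < c2, D c1 & D c2].
  case: int_D => c /= /nbhs_ballP[e /= e0 ceD].
  have Dc y : `|c - y| < e -> D y by move/ceD; rewrite /posset /= mxeval_linpoly.
  exists c, (c + e / 2); split; first by rewrite ltrDl divr_gt0.
    by apply: Dc; rewrite subrr normr0.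
  apply: Dc; rewrite opprD addrA subrr add0r normrN gtr0_norm ?divr_gt0 //.
  by rewrite ltr_pdivrMr // mulr_natr mulr2n ltrDl.
have L2E y : linpoly R0 R1 = map_mx polyC (R0 + y *: R1)
    + ('X - y%:P) *: map_mx polyC R1.
  rewrite /linpoly map_mxD map_mxZ scalerBl addrACA.
  by rewrite subrr addr0.
rewrite -/(in_module (linpoly P0 P1) (linpoly R0 R1)).
have left_edge : (exists a (v : 'cV[R]_d),
    [/\ D a, a <= c1 & qform (linpoly P0 P1) (map_mx polyC v) = 'X - a%:P])
    \/ psdmx (- R1).
  have [[z zD]|noz] := pselect (exists z, forall y, D y -> z <= y).
    left; have [a [v [Da ac1 v0 v1]]] := pencil_edge P0s P1s c12 Dc1 Dc2 zD.
    exists a, v; split=> //.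
    by rewrite qform_linpoly v0 v1 mulr1 polyCN addrC.
  right; apply/psdmxP; split=> [|v]; first by rewrite linearN /= R1s.
  apply: (@affine_slope_ge0 _ (qform R0 v)) => z; apply: contrapT => nz.
  apply: noz; exists (- z) => y Dy; rewrite leNgt; apply/negP => yz.
  apply: nz; exists (- y); first by rewrite lerNr ltW.
  have /psdmxP[_ /(_ v)] := L2D _ Dy.
  by rewrite qform_pencil -[- R1]scaleN1r qformZ mulN1r mulrNN.
have right_edge : (exists b (v : 'cV[R]_d),
    [/\ D b, c2 <= b & qform (linpoly P0 P1) (map_mx polyC v) = b%:P - 'X])
    \/ psdmx R1.
  have [[z zD]|noz] := pselect (exists z, forall y, D y -> y <= z).
    have P1s' : (- P1)^T = - P1 by rewrite linearN /= P1s.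
    have DN y : P0 + y *: - P1 = P0 + (- y) *: P1 by rewrite scalerN scaleNr.
    have c12' : - c2 < - c1 by rewrite ltrN2.
    (* The right endpoint is the left endpoint of the reflected pencil. *)
    left; have [||y|a [v [Da ac1 v0 v1]]] :=
      @pencil_edge _ _ P0 (- P1) _ _ (- z) P0s P1s' c12'.
    - by rewrite DN opprK.
    - by rewrite DN opprK.
    - by rewrite DN => /zD; rewrite lerNl.
    exists (- a), v; split; first by move: Da; rewrite DN.
      by rewrite lerNr.
    have -> : P1 = -1 *: - P1 by rewrite scalerN scaleN1r opprK.
    by rewrite qform_linpoly v0 qformZ v1 mulr1 !polyCN mulrN1.
  right; apply/psdmxP; split=> // v.
  apply: (@affine_slope_ge0 _ (qform R0 v)) => z; apply: contrapT => nz.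
  apply: noz; exists z => y Dy; rewrite leNgt; apply/negP => yz.
  apply: nz; exists y; first exact: ltW.
  by have /psdmxP[_ /(_ v)] := L2D _ Dy; rewrite qform_pencil.
case: left_edge right_edge => [[a [v [Da ac1 va]]]|R1N] [[b [w [Db bc2 wb]]]|R1P].
(* D bounded: interpolation between the endpoints. *)
- have ab : 0 < b - a by rewrite subr_gt0; lra.
  have k0 : 0 <= (b - a)^-1 by rewrite invr_ge0 ltW.
  have := in_moduleD (in_module_qform (linpoly P0 P1) (map_mx polyC v)
                        (psdmxZ k0 (L2D b Db)))
                     (in_module_qform (linpoly P0 P1) (map_mx polyC w)
                        (psdmxZ k0 (L2D a Da))).
  suff -> : linpoly R0 R1 =
      qform (linpoly P0 P1) (map_mx polyC v)
        *: map_mx polyC ((b - a)^-1 *: (R0 + b *: R1))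
    + qform (linpoly P0 P1) (map_mx polyC w)
        *: map_mx polyC ((b - a)^-1 *: (R0 + a *: R1)) by [].
  rewrite va wb; apply/matrixP => i j; rewrite !mxE !polyCM !polyCD !polyCM.
  have : (b - a)^-1%:P * (b%:P - a%:P) = 1 :> {poly R}.
    by rewrite -polyCB -polyCM mulVf // gt_eqF.
  move: (_^-1%:P) => k ke.
  rewrite -[LHS]mul1r -{}ke; ring.
- rewrite (L2E a) -va; apply: in_moduleD; first exact/in_module_const/L2D.
  exact: in_module_qform.
- rewrite (L2E b) -opprB scaleNr -scalerN -map_mxN -wb.
  apply: in_moduleD; first exact/in_module_const/L2D.
  exact: in_module_qform.
(* D unbounded on both sides: the symmetric matrices R1 and - R1 are PSD. *)
- have R10 : R1 = 0.
    apply/matrixP => i j; rewrite [RHS]mxE.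
    have /(psdmx_qform0 R1P)/matrixP/(_ i 0) : qform R1 (delta_mx j 0) = 0.
      have /psdmxP[_ /(_ (delta_mx j 0))] := R1P.
      have /psdmxP[_ /(_ (delta_mx j 0))] := R1N.
      rewrite -[- R1]scaleN1r qformZ; lra.
    by rewrite -colE !mxE.
  rewrite (L2E c1) [X in _ *: map_mx _ X]R10 map_mx0 scaler0 addr0.
  exact/in_module_const/L2D.
Qed.
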